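(* Let $(X,d)$ be a locally compact metric space, let $(X,\mathbb{R},\phi)$ be a dynamical system on $X$, and let $M\subset X$ be a non-empty compact set. Then $M$ is (Lyapunov) asymptotically stable under $\phi$ if and only if there exist a neighborhood $N$ of $M$ and a continuous real valued function $L: N\to\mathbb{R}$ such that (i) $L(x)=0$ for all $x\in M$, and $L(x)>0$ for all $x\in N\setminus M$; (ii) $L(\phi(x,t))<L(x)$ for all $x\in N\setminus M$ and all $t>0$ with $\phi(x,[0,t])\subset N$.
   Context: A dynamical system on a metric space $X$ is a triplet $(X,\mathbb{R},\phi)$ where $\phi:X\times\mathbb{R}\to X$ is continuous, $\phi(x,0)=x$ for all $x\in X$, and $\phi(\phi(x,t_1),t_2)=\phi(x,t_1+t_2)$ for all $x\in X$, $t_1,t_2\in\mathbb{R}$. For $T\subset\mathbb{R}$, $\phi(x,T)=\{\phi(x,t):t\in T\}$. A neighborhood of $M$ is a set $U\subset X$ (not necessarily open) containing an open set $V$ with $M\subset V$. The positive semi-trajectory through $x$ is $\gamma^+(x)=\{\phi(x,t):t\ge 0\}$, and $\gamma^+(A)=\bigcup_{x\in A}\gamma^+(x)$ for $A\subset X$. The $\Omega$-limit of $x$ is $\Omega(x)=\{y\in X:\text{ there is a sequence } t_n\to+\infty \text{ with } \phi(x,t_n)\to y\}$. The region of attraction of $M$ is $A(M)=\{x\in X:\Omega(x)\neq\emptyset \text{ and } \Omega(x)\subset M\}$. $M$ is an attractor (attracting) if $A(M)$ is a neighborhood of $M$. The compact set $M$ is Lyapunov stable under $\phi$ if for every neighborhood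 $N$ of $M$ there exists a neighborhood $N'$ of $M$ such that $\gamma^+(N')\subset N$. $M$ is (Lyapunov) asymptotically stable if it is Lyapunov stable and attracting. *)

(* Defs.v *)
From mathcomp Require Import all_boot all_order all_algebra.
From mathcomp Require Import all_classical all_reals all_analysis.

Set Implicit Arguments.
Unset Strict Implicit.
Unset Printing Implicit Defensive.

Import Order.TTheory GRing.Theory Num.Theory.
Import numFieldNormedType.Exports.

Local Open Scope classical_set_scope.
Local Open Scope ring_scope.

(* Neighborhoods of a set are the members of the library filter [set_nbhs M]:
   by [set_nbhsP], these are the (not necessarily open) sets containing an
   open set that contains M. *)

Section dynamical_systems.
Context {R : realType} {X : metricType R}.
Implicit Types (phi : X * R -> X) (x : X) (A M : set X).

(* Continuity is joint continuity, for the product topology on X * R. *)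
Definition dynamical_system phi : Prop :=
  [/\ continuous phi,
      forall x, phi (x, 0) = x &
      forall x (t1 t2 : R), phi (phi (x, t1), t2) = phi (x, t1 + t2)].

Definition flow_image phi x (T : set R) : set X := [set phi (x, t) | t in T].

Definition pos_semitrajectory phi x : set X := flow_image phi x `[0, +oo[.

Definition pos_semitrajectory_set phi A : set X :=
  \bigcup_(x in A) pos_semitrajectory phi x.

Definition omega_limit phi x : set X :=
  [set y | exists2 t : nat -> R,
     t n @[n --> \oo] --> +oo & phi (x, t n) @[n --> \oo] --> y].

Definition region_of_attraction phi M : set X :=
  [set x | omega_limit phi x !=set0 /\ omega_limit phi x `<=` M].

Definition attracting phi M : Prop := set_nbhs M (region_of_attraction phi M).

Definition lyapunov_stable phi M : Prop :=
  forall N, set_nbhs M N ->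
    exists2 N', set_nbhs M N' & pos_semitrajectory_set phi N' `<=` N.

Definition asymptotically_stable phi M : Prop :=
  lyapunov_stable phi M /\ attracting phi M.

End dynamical_systems.

(* Main.v *)
Require Import Defs.
From mathcomp Require Import all_boot all_order all_algebra.
From mathcomp Require Import all_classical all_reals all_analysis.
From mathcomp Require Import ring lra.
Import Order.TTheory GRing.Theory Num.Theory.
Import numFieldNormedType.Exports.
Local Open Scope classical_set_scope.
Local Open Scope ring_scope.
Set Implicit Arguments.
Unset Strict Implicit.
Unset Printing Implicit Defensive.

(** From a Lyapunov function to stability: take a compact neighborhood [K] of
    [M] inside [N], and let [m > 0] be a lower bound of [L] on its boundary.
    Since [L] decreases along orbits, an orbit starting in [K] with [L < m]
    cannot cross the boundary of [K].  Such an orbit has a nonempty limit set, and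
    [L] takes its limit value along the orbit on all of it; by strict decrease the
    limit set lies in [M].

    Conversely [L x = sup_(t >= 0) c(t) d(phi(x, t), M)], where
    [c(t) = 2 - 1 / (1 + t)] increases strictly from 1 to 2, works on the region
    of attraction.  There the tails of [d(phi(x, t), M)] are small locally
    uniformly in [x], by stability, so [L] is finite and continuous.  Replacing
    [x] by [phi(x, t)] shifts the orbit, hence lowers the weights on the bounded
    time interval where the supremum is decided. *)

(** * Distance to a nonempty set *)

Section set_distance.
Context {R : realType} {X : metricType R} (M : set X).

Definition set_dist (x : X) : R := inf [set mdist x y | y in M].

Lemma set_dist_has_lbound x : has_lbound [set mdist x y | y in M].
Proof. by exists 0 => _ [y My <-]; exact: mdist_ge0. Qed.

Lemma set_dist_le x y : M y -> set_dist x <= mdist x y.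
Proof.
by move=> My; apply: ge_inf; [exact: set_dist_has_lbound | exists y].
Qed.

Hypothesis M0 : M !=set0.

Lemma set_dist_ge0 x : 0 <= set_dist x.
Proof.
apply: lb_le_inf; last by move=> _ [y My <-]; exact: mdist_ge0.
by have [y My] := M0; exists (mdist x y), y.
Qed.

Lemma set_dist_triangle x y : set_dist x <= mdist x y + set_dist y.
Proof.
rewrite -lerBlDl; apply: lb_le_inf.
  by have [z Mz] := M0; exists (mdist y z), z.
move=> _ [z Mz <-]; rewrite lerBlDl.
exact: le_trans (set_dist_le x Mz) (metric_triangle _ _ _).
Qed.

Lemma ball_set_dist x y e : ball x e y -> `|set_dist x - set_dist y| <= e.
Proof.
rewrite ballEmdist/= => /ltW xy; rewrite ler_norml lerBlDr lerNl opprB lerBlDr.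
have := set_dist_triangle y x; rewrite metric_sym => yx.
rewrite (le_trans yx) ?lerD2r//=.
by rewrite (le_trans (set_dist_triangle x y)) ?lerD2r.
Qed.

Lemma set_dist_gt0 x : closed M -> ~ M x -> 0 < set_dist x.
Proof.
move=> clM nMx; rewrite lt_neqAle set_dist_ge0 andbT eq_sym.
apply/eqP => dx0; apply: nMx; apply: clM => B /nbhs_ballP[e /= e0 Be].
have hi : has_inf [set mdist x y | y in M].
  by split; [have [y My] := M0; exists (mdist x y), y|
    exact: set_dist_has_lbound].
have [_ [y My <-]] := inf_adherent e0 hi; rewrite -/(set_dist x) dx0 add0r.
by move=> xy; exists y; split => //; apply: Be; rewrite ballEmdist.
Qed.

Lemma set_nbhs_set_dist e : 0 < e -> set_nbhs M [set x | set_dist x < e].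
Proof.
move=> e0 x Mx; apply: filterS (near_ball x e e0) => y /=.
rewrite ballEmdist/= metric_sym; apply: le_lt_trans.
exact: set_dist_le.
Qed.

End set_distance.

(** * Topological preliminaries: relative continuity, compact neighborhoods, exit times *)

Lemma continuous_comp_within {S T U : topologicalType} (f : S -> T) (g : T -> U)
    (A : set S) (B : set T) :
  continuous f -> (forall s, A s -> B (f s)) -> {within B, continuous g} ->
  {within A, continuous (g \o f)}.
Proof.
move=> cf AB cg; apply/subspace_continuousP => s As P gP.
have Bg : \forall z \near f s, B z -> P (g z).
  exact ((subspace_continuousP B g).1 cg (f s) (AB s As) P gP).
have fBg : \forall r \near s, B (f r) -> P (g (f r)) := cf s _ Bg.
by apply: filterS fBg => r + Ar; apply; exact: AB.
Qed.

Lemma cvg_within_comp {I : Type} {F : set_system I} {FF : Filter F}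
    {T U : topologicalType} (f : I -> T) (g : T -> U) (B : set T) (y : T) :
  {within B, continuous g} -> (\forall i \near F, B (f i)) -> B y ->
  f i @[i --> F] --> y -> g (f i) @[i --> F] --> g y.
Proof.
move=> /subspace_continuousP cg fB By fy P /(cg y By) gP.
have fBg : \forall i \near F, B (f i) -> P (g (f i)) := fy _ gP.
by apply: filterS2 fB fBg => i Bfi; apply.
Qed.

(** Compactness of [M] is used in near-covering form: along the compact subsets of [U] directed by
    inclusion, each point of [M] is eventually interior, hence all of [M] is at once. *)
Lemma compact_set_nbhs {R : realType} {X : metricType R} (M U : set X) :
  locally_compact [set: X] -> compact M -> set_nbhs M U ->
  exists K, [/\ compact K, set_nbhs M K & K `<=` U].
Proof.
move=> lcX cM MU.
have CP x : exists C, M x -> [/\ compact C, nbhs x C & C `<=` U].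
  have [Mx|nMx] := pselect (M x); last by exists set0.
  have [W xW WU] := @uniform_regular X x U (MU x Mx).
  have := lcX x I; rewrite withinET => -[V xV [cV _]].
  exists (V `&` closure W) => _; split.
  - by apply: compact_closedI => //; exact: closed_closure.
  - by apply: filterI => //; apply: filterS xW; exact: subset_closure.
  - by move=> y [_ /WU].
have [C CE] := choice CP.
pose good := [set K | compact K /\ K `<=` U].
pose F := filter_from good (fun K => [set K' | good K' /\ K `<=` K']).
have FF : Filter F.
  apply: filter_from_filter; first by exists set0; split; [exact: compact0|].
  move=> K1 K2 [cK1 K1U] [cK2 K2U]; exists (K1 `|` K2).
    by split; [exact: compactU | rewrite subUset].
  by move=> K [gK]; rewrite subUset => -[].
have /compact_near_coveringP/(_ _ F (fun K x => K° x) FF) := cM.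
case=> [x Mx|K [cK KU] KM].
  have [cC xC CU] := CE x Mx.
  exists ((C x)°, [set K | good K /\ C x `<=` K]).
    by split; [exact: nbhs_interior | exists (C x)].
  by move=> [y K] [/= yC [_ CK]]; exact: filterS yC.
have KMK := KM K (conj (conj cK KU) (@subset_refl _ K)).
by exists K; split=> // x /KMK.
Qed.

(** The witness is the infimum of the times spent outside [K]: closedness keeps that instant in [K],
    while exit times arbitrarily close to it rule out the interior. *)
Lemma first_exit {R : realType} {T : topologicalType} (f : R -> T) (K : set T)
    (t : R) :
  closed K -> continuous f -> K (f 0) -> 0 <= t -> ~ K (f t) ->
  exists r, [/\ 0 <= r, forall s, 0 <= s <= r -> K (f s) & ~ K° (f r)].
Proof.
move=> clK cf K0 t0 nKt; pose E := [set s | 0 <= s /\ ~ K (f s)].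
have Elb : has_lbound E by exists 0 => s [].
have E0 : E !=set0 by exists t.
have r0 : 0 <= inf E by apply: lb_le_inf => // s [].
have Klt s : 0 <= s < inf E -> K (f s).
  move=> /andP[s0 sE]; apply: contrapT => nKs.
  by move: sE; rewrite ltNge => /negP; apply; exact: ge_inf.
have Kr : K (f (inf E)).
  have [<-//|rneq0] := eqVneq 0 (inf E).
  apply: contrapT => nKr.
  have rgt0 : 0 < inf E by rewrite lt_neqAle rneq0.
  have /cf/nbhs_ballP : nbhs (f (inf E)) (~` K).
    by apply: open_nbhs_nbhs; split => //; exact: closed_openC.
  (* Stepping back by at most [e / 2], capped at [inf E] to keep the time nonnegative, reaches an
     earlier instant, where the path is still in [K]. *)
  case=> e /= e0 /(_ (inf E - Num.min (inf E) (e / 2))).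
  have d0 : 0 < Num.min (inf E) (e / 2) by rewrite lt_min rgt0 divr_gt0.
  apply; last first.
    by apply: Klt; rewrite subr_ge0 ge_min lexx /= ltrBlDr ltrDl.
  rewrite /ball/= opprB addrC subrK gtr0_norm// gt_min; apply/orP; right.
  by rewrite ltr_pdivrMr// mulr_natr mulr2n ltrDl.
exists (inf E); split => //.
  move=> s /andP[s0]; rewrite le_eqVlt => /predU1P[->//|sr].
  by apply: Klt; rewrite s0.
move=> /cf rK.
have /nbhs_ballP[e /= e0 eK] : nbhs (inf E) (f @^-1` K) := rK.
have [s Es sr] := inf_adherent e0 (conj E0 Elb).
apply: (Es.2); apply: eK; rewrite /ball/= distrC ger0_norm ?ltrBlDl//.
by rewrite subr_ge0; exact: ge_inf.
Qed.

(** * Continuity properties of the flow *)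

Section flow.
Context {R : realType} {X : metricType R}.
Variable phi : X * R -> X.
Hypothesis phi_dyn : dynamical_system phi.

Lemma flow_continuous : continuous phi.
Proof. by have [] := phi_dyn. Qed.

Lemma flow0 x : phi (x, 0) = x.
Proof. by have [_ + _] := phi_dyn. Qed.

Lemma flowD x t1 t2 : phi (phi (x, t1), t2) = phi (x, t1 + t2).
Proof. by have [_ _] := phi_dyn. Qed.

Lemma flow_continuous_time x : continuous (fun t => phi (x, t)).
Proof.
move=> t; apply: (cvg_comp (fun s => (x, s)) phi _ (@flow_continuous (x, t))).
by apply: (@cvg_pair _ _ _ _ (nbhs x) (nbhs t));
  [exact: cvg_cst | exact: cvg_id].
Qed.

Lemma flow_continuous_space t : continuous (fun x => phi (x, t)).
Proof.
move=> x; apply: (cvg_comp (fun y => (y, t)) phi _ (@flow_continuous (x, t))).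
by apply: (@cvg_pair _ _ _ _ (nbhs x) (nbhs t));
  [exact: cvg_id | exact: cvg_cst].
Qed.

(** A tube argument: near each [(x, t)] both [phi (x, s)] and [phi (y, s)] are within [e / 2] of
    [phi (x, t)], and compactness of [A] makes the neighborhood of [x] uniform in time. *)
Lemma flow_near_uniform x (A : set R) e : compact A -> 0 < e ->
  \forall y \near x, forall t, A t -> ball (phi (x, t)) e (phi (y, t)).
Proof.
move=> /compact_near_coveringP cA e0.
apply: (cA _ (nbhs x) (fun y t => ball (phi (x, t)) e (phi (y, t)))) => t At.
have e20 : 0 < e / 2 by rewrite divr_gt0.
have /cvg_ballP/(_ _ e20)[[U V] /= [xU tV] UV] := @flow_continuous (x, t).
have /cvg_ballP/(_ _ e20) tW := @flow_continuous_time x t.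
exists ([set s | V s /\ ball (phi (x, t)) (e / 2) (phi (x, s))], U).
  by split; [exact: filterI tV tW | exact: xU].
move=> [s y] [/= [Vs xs] Uy]; apply: (@ball_splitr _ _ (phi (x, t))) => //.
exact: (UV (y, s)).
Qed.

Lemma pos_semitrajectoryP x y :
  pos_semitrajectory phi x y <-> exists2 t, 0 <= t & phi (x, t) = y.
Proof.
by split=> -[t t0 <-]; exists t => //; move: t0; rewrite /= in_itv/= andbT.
Qed.

End flow.

(** * From asymptotic stability to a Lyapunov function *)

Section lyapunov_function.
Context {R : realType} {X : metricType R}.
Variables (phi : X * R -> X) (M : set X).
Hypothesis phi_dyn : dynamical_system phi.
Hypothesis M0 : M !=set0.

Definition weight (t : R) : R := 2 - (1 + t)^-1.

Lemma weight_bounds t : 0 <= t -> 1 <= weight t <= 2.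
Proof.
move=> t0; have t1 : 0 < 1 + t by rewrite ltr_wpDr.
have i0 : 0 <= (1 + t)^-1 by rewrite invr_ge0 ltW.
have i1 : (1 + t)^-1 <= 1 by rewrite invf_le1// lerDl.
by rewrite /weight; apply/andP; split; lra.
Qed.

(** The increment [weight (t + s) - weight t] equals [s / ((1 + t) * (1 + t + s))], which decreases
    in [t]; its value at [T] serves as [e]. *)
Lemma weight_gap T s : 0 <= T -> 0 < s -> exists2 e, 0 < e &
  forall t, 0 <= t <= T -> weight t + e <= weight (t + s).
Proof.
move=> T0 s0; have T1 : 0 < 1 + T by rewrite ltr_wpDr.
have Ts1 : 0 < 1 + T + s by rewrite addr_gt0.
exists (s / ((1 + T) * (1 + T + s))); first by rewrite divr_gt0// mulr_gt0.
move=> t /andP[t0 tT]; rewrite /weight.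
have t1 : 0 < 1 + t by rewrite ltr_wpDr.
have ts1 : 0 < 1 + t + s by rewrite addr_gt0.
have -> : 2 - (1 + (t + s))^-1 = 2 - (1 + t)^-1 + s / ((1 + t) * (1 + t + s)).
  by rewrite addrA; field; rewrite !lt0r_neq0.
rewrite lerD2l ler_pM2l// lef_pV2 ?posrE ?mulr_gt0//.
by rewrite ler_pM ?lerD2r ?lerD2l// ltW.
Qed.

Lemma set_dist_continuous : continuous (set_dist M).
Proof.
move=> x; apply/cvgrPdist_le => e e0.
by apply: filterS (near_ball x e e0) => y; exact: ball_set_dist.
Qed.

Definition weighted_dist (x : X) (t : R) : R :=
  weight t * set_dist M (phi (x, t)).

(** The supremum is informative only where the set is bounded above, which [lyap_has_ubound] and
    [attraction_tail] ensure on the region of attraction of a stable [M]. *)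
Definition lyap (x : X) : R :=
  sup [set weighted_dist x t | t in [set t | 0 <= t]].

Definition dist_tail_lt (x : X) (e T : R) : Prop :=
  forall t, T <= t -> set_dist M (phi (x, t)) < e.

Lemma weighted_dist_le2 x t : 0 <= t ->
  weighted_dist x t <= 2 * set_dist M (phi (x, t)).
Proof.
by move=> /weight_bounds/andP[_ w2]; rewrite ler_wpM2r ?set_dist_ge0.
Qed.

Lemma lyap_has_ubound x e T : 0 <= T -> dist_tail_lt x e T ->
  has_ubound [set weighted_dist x t | t in [set t | 0 <= t]].
Proof.
move=> T0 xT.
have [|c _ cmax] := @EVT_max R (fun t => set_dist M (phi (x, t))) 0 T T0.
  apply: continuous_subspaceT => t.
  apply: (cvg_comp (fun s => phi (x, s)) (set_dist M)).
    exact: flow_continuous_time.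
  exact: set_dist_continuous.
exists (2 * Num.max e (set_dist M (phi (x, c)))) => _ [t /= t0 <-].
rewrite (le_trans (weighted_dist_le2 x t0))// ler_pM2l// le_max.
have [Tt|tT] := leP T t; first by rewrite ltW ?xT.
by rewrite cmax ?orbT// in_itv/= t0 ltW.
Qed.

Lemma lyap_ge x t :
  has_ubound [set weighted_dist x t | t in [set t | 0 <= t]] ->
  0 <= t -> weighted_dist x t <= lyap x.
Proof. by move=> xub t0; apply: ub_le_sup => //; exists t. Qed.

Lemma lyap_le x c : (forall t, 0 <= t -> weighted_dist x t <= c) -> lyap x <= c.
Proof.
move=> xc; apply: ge_sup; first by exists (weighted_dist x 0), 0 => /=.
by move=> _ [t t0 <-]; exact: xc.
Qed.

(** The factor 2 bounds the weights. The estimate is one-sided, so continuity follows by applying it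
    in both directions. *)
Lemma lyap_le_perturb x y e :
  has_ubound [set weighted_dist x t | t in [set t | 0 <= t]] -> 0 <= e ->
  (forall t, 0 <= t ->
    set_dist M (phi (y, t)) <= set_dist M (phi (x, t)) + e) ->
  lyap y <= lyap x + 2 * e.
Proof.
move=> xub e0 xy; apply: lyap_le => t t0.
have /andP[w1 w2] := weight_bounds t0.
have w0 : 0 <= weight t by rewrite (le_trans _ w1).
rewrite (le_trans (ler_wpM2l w0 (xy t t0)))// mulrDr lerD ?ler_wpM2r//.
exact: lyap_ge.
Qed.

Hypothesis M_stable : lyapunov_stable phi M.

(** The orbit of [x] enters a neighborhood [N'] given by stability at some time [u n]. By continuity
    of the flow at that fixed time, so do the orbits of nearby points, and stability then keeps them
    close to [M]. *)
Lemma attraction_tail x e : region_of_attraction phi M x -> 0 < e ->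
  exists2 T, 0 <= T & \forall y \near x, dist_tail_lt y e T.
Proof.
move=> [[y Ey] xM] e0; have My := xM _ Ey; have [u uoo uy] := Ey.
have [N' MN' N'e] := M_stable (set_nbhs_set_dist e0).
have yN' : \forall n \near \oo, N'° (phi (x, u n)).
  by apply: uy; exact: nbhs_interior (MN' y My).
have u0 : \forall n \near \oo, 0 <= u n by have /cvgryPge/(_ 0) := uoo.
have [n [Nn un]] := filter_ex (filterI yN' u0).
have xN : \forall z \near x, N' (phi (z, u n)).
  exact: (flow_continuous_space phi_dyn Nn).
exists (u n) => //; apply: filterS xN => z N'z t unt; apply: N'e.
exists (phi (z, u n)) => //.
apply/pos_semitrajectoryP; exists (t - u n); first by rewrite subr_ge0.
by rewrite flowD// addrC subrK.
Qed.

Lemma lyap_continuous x : region_of_attraction phi M x ->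
  {for x, continuous lyap}.
Proof.
move=> Ax; apply/cvgrPdist_le => e e0.
have e20 : 0 < e / 2 by rewrite divr_gt0.
have [T T0 xT] := attraction_tail Ax e20.
have xx := nbhs_singleton xT.
have := flow_near_uniform phi_dyn x (@segment_compact R 0 T) e20.
apply: filter_app; apply: filterS xT => y yT xy.
(* After [T] both distances lie between 0 and [e / 2]; before [T] the two orbits are uniformly
   close. *)
have dxy t : 0 <= t ->
    `|set_dist M (phi (x, t)) - set_dist M (phi (y, t))| <= e / 2.
  move=> t0; have [Tt|tT] := leP T t.
    have := xx t Tt; have := yT t Tt.
    have := set_dist_ge0 M0 (phi (x, t)); have := set_dist_ge0 M0 (phi (y, t)).
    by move=> *; rewrite ler_norml; apply/andP; split; lra.
  by apply: ball_set_dist => //; apply: xy; rewrite /= in_itv/= t0 ltW.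
have ee : e = 2 * (e / 2) by field.
rewrite ler_distl; apply/andP; split; rewrite ee ?lerBlDr.
  apply: lyap_le_perturb; [exact: lyap_has_ubound T0 xx | exact: ltW |].
  by move=> t /dxy; rewrite ler_distl lerBlDr => /andP[].
apply: lyap_le_perturb; [exact: lyap_has_ubound T0 yT | exact: ltW |].
by move=> t /dxy; rewrite ler_distl => /andP[].
Qed.

Lemma lyap0 x : M x -> lyap x = 0.
Proof.
(* Stability keeps the orbit of a point of [M] within every [e > 0] of [M]. *)
move=> Mx; have d0 t : 0 <= t -> set_dist M (phi (x, t)) = 0.
  move=> t0; apply/eqP; rewrite eq_le set_dist_ge0// andbT.
  apply/ler_addgt0Pl => e e0; rewrite addr0.
  have [N' MN' N'e] := M_stable (set_nbhs_set_dist e0).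
  apply/ltW/N'e; exists x; first exact: nbhs_singleton (MN' x Mx).
  by apply/pos_semitrajectoryP; exists t.
have w0 t : 0 <= t -> weighted_dist x t = 0.
  by move=> /d0; rewrite /weighted_dist => ->; rewrite mulr0.
apply/eqP; rewrite eq_le lyap_le => [|t /w0 ->//]; rewrite -(w0 0)// lyap_ge//.
by exists 0 => _ [t /= t0 <-]; rewrite w0.
Qed.

Hypothesis M_closed : closed M.

Lemma lyap_gt0 x : region_of_attraction phi M x -> ~ M x -> 0 < lyap x.
Proof.
move=> Ax nMx; have [T T0 /nbhs_singleton xT] := attraction_tail Ax ltr01.
apply: (lt_le_trans (set_dist_gt0 M0 M_closed nMx)).
rewrite (le_trans _ (lyap_ge (lyap_has_ubound T0 xT) (lexx 0)))//.
have /andP[w1 _] := weight_bounds (lexx 0).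
by rewrite /weighted_dist flow0// ler_peMl ?set_dist_ge0.
Qed.

(** Compare each weighted distance of the shifted orbit with [lyap x]. A distance of at most
    [lyap x / 4] contributes at most half of [lyap x], as weights are at most 2. A larger one occurs
    only at a time [s <= T], where the shift costs at least [e] in weight. The minimum of the two
    margins is a uniform loss, so the supremum drops strictly. *)
Lemma lyap_lt x t : region_of_attraction phi M x -> ~ M x -> 0 < t ->
  lyap (phi (x, t)) < lyap x.
Proof.
move=> Ax nMx t0; have Lx := lyap_gt0 Ax nMx.
have a0 : 0 < lyap x / 4 by rewrite divr_gt0.
have [T T0 /nbhs_singleton xT] := attraction_tail Ax a0.
have [e e0 we] := weight_gap T0 t0.
have m0 : 0 < Num.min (lyap x / 2) (e * (lyap x / 4)).
  by rewrite lt_min (mulr_gt0 e0 a0) andbT divr_gt0.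
suff : lyap (phi (x, t)) <= lyap x - Num.min (lyap x / 2) (e * (lyap x / 4)).
  by move=> /le_lt_trans; apply; rewrite ltrBlDr ltrDl.
apply: lyap_le => s s0; rewrite lerBrDr addrC -lerBrDr ge_min; apply/orP.
have [dle|dgt] := leP (set_dist M (phi (phi (x, t), s))) (lyap x / 4).
  left; rewrite lerBrDr; have := weighted_dist_le2 (phi (x, t)) s0; lra.
right; rewrite lerBrDr.
have sT : s <= T.
  rewrite leNgt; apply/negP => Ts; move: dgt; rewrite flowD// ltNge ltW ?xT//.
  by rewrite (le_trans (ltW Ts))// lerDr ltW.
have w := we s (introT andP (conj s0 sT)).
have st0 : 0 <= s + t by rewrite addr_ge0// ltW.
rewrite (le_trans _ (lyap_ge (lyap_has_ubound T0 xT) st0))// /weighted_dist.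
move: w; rewrite (addrC s t) -flowD// => w.
apply: le_trans (ler_wpM2r (set_dist_ge0 M0 _) w).
by rewrite [leLHS]addrC (mulrDl (weight s)) lerD2l ler_pM2l ?ltW.
Qed.

End lyapunov_function.

(** * From a Lyapunov function to asymptotic stability *)

Section lyapunov_sufficient.
Context {R : realType} {X : metricType R}.
Variables (phi : X * R -> X) (M N : set X) (L : X -> R).
Hypothesis phi_dyn : dynamical_system phi.
Hypothesis L_continuous : {within N, continuous L}.
Hypothesis L0 : forall x, M x -> L x = 0.
Hypothesis L_gt0 : forall x, (N `\` M) x -> 0 < L x.
Hypothesis L_lt : forall x t, (N `\` M) x -> 0 < t ->
  flow_image phi x `[0, t] `<=` N -> L (phi (x, t)) < L x.

Lemma flow_imageP x t A :
  flow_image phi x `[0, t] `<=` A <-> forall s, 0 <= s <= t -> A (phi (x, s)).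
Proof.
split=> [xA s st|xA _ [s st <-]]; last first.
  by apply: xA; move: st; rewrite /= in_itv.
by apply: xA; exists s => //; rewrite /= in_itv.
Qed.

(* For [x] in [M], where strict decrease says nothing, a positive value of [L]
   at time [t] would be preceded, by the IVT, by half that value. *)
Lemma L_nonincreasing x t : 0 <= t ->
  (forall s, 0 <= s <= t -> N (phi (x, s))) ->
  L (phi (x, t)) <= L x.
Proof.
move=> t0 xN.
have Nx : N x by rewrite -(flow0 phi_dyn x); apply: xN; rewrite lexx.
have [Mx|nMx] := pselect (M x); last first.
  move: t0; rewrite le_eqVlt => /predU1P[<-|t0]; first by rewrite flow0.
  by apply/ltW/L_lt => //; apply/flow_imageP.
rewrite (L0 Mx) leNgt; apply/negP => Lt0.
have /IVT : {within `[0, t], continuous (L \o (fun s => phi (x, s)))}.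
  apply: continuous_comp_within L_continuous; first exact: flow_continuous_time.
  by move=> s; rewrite /= in_itv; exact: xN.
move=> /(_ (L (phi (x, t)) / 2) t0) /=.
rewrite flow0// (L0 Mx) (min_l (ltW Lt0)) (max_r (ltW Lt0)).
case=> [|s]; first by apply/andP; split; move: Lt0; lra.
rewrite in_itv/= => /andP[s0 st] Ls.
have Ls0 : 0 < L (phi (x, s)) by rewrite Ls divr_gt0.
have nMs : ~ M (phi (x, s)) by move=> /L0 Ls'; rewrite Ls' ltxx in Ls0.
have st' : s < t.
  rewrite lt_neqAle st andbT; apply/eqP => sE.
  by move: Ls Lt0; rewrite sE; lra.
have : L (phi (phi (x, s), t - s)) < L (phi (x, s)).
  apply: L_lt; first by split => //; apply: xN; rewrite s0.
    by rewrite subr_gt0.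
  apply/flow_imageP => r /andP[r0 rt]; rewrite flowD//; apply: xN.
  by rewrite addr_ge0//= addrC -lerBrDr.
by rewrite flowD// addrC subrK Ls; move: Lt0; lra.
Qed.

Lemma L_nonincreasing2 x s t : (forall r, 0 <= r -> N (phi (x, r))) ->
  0 <= s <= t -> L (phi (x, t)) <= L (phi (x, s)).
Proof.
move=> xN /andP[s0 st].
have -> : phi (x, t) = phi (phi (x, s), t - s) by rewrite flowD// addrC subrK.
apply: L_nonincreasing; first by rewrite subr_ge0.
by move=> r /andP[r0 _]; rewrite flowD//; apply: xN; rewrite addr_ge0.
Qed.

Lemma sublevel_positively_invariant K m x t : closed K -> K `<=` N ->
  (forall y, (K `\` K°) y -> m <= L y) -> K x -> L x < m -> 0 <= t ->
  K (phi (x, t)).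
Proof.
move=> clK KN Km Kx Lxm t0; apply: contrapT => nK.
have := first_exit clK (@flow_continuous_time _ _ _ phi_dyn x) _ t0 nK.
case=> [|r [r0 rK nKr]]; first by rewrite flow0.
(* At the first exit the orbit is on the boundary of [K], but it has stayed in [N] so far, so [L]
   cannot have risen to [m]. *)
have : m <= L (phi (x, r)) by apply: Km; split=> //; apply: rK; rewrite r0/=.
apply/negP; rewrite -ltNge; apply: le_lt_trans Lxm.
by apply: L_nonincreasing => // s /rK/KN.
Qed.

Lemma compact_L_ge K : compact K -> K `<=` N -> (forall x, K x -> ~ M x) ->
  exists2 m, 0 < m & forall x, K x -> m <= L x.
Proof.
(* The empty case does arise: a neighborhood that is both open and closed has no boundary, and any
   positive bound will do. *)
move=> cK KN KM; have [->|/set0P K0] := eqVneq K set0; first by exists 1.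
have [c /set_mem Kc Lc] :=
  compact_EVT_min K0 cK (continuous_subspaceW KN L_continuous).
exists (L c); first by apply: L_gt0; split; [exact: KN | exact: KM].
by move=> x Kx; apply: Lc; exact: mem_set.
Qed.

(** Continuity of [L] is only relative to [N], but [N] is a full neighborhood of each point of
    [M]. *)
Lemma near_L_lt x m : M x -> set_nbhs M N -> 0 < m ->
  \forall y \near x, L y < m.
Proof.
move=> Mx MN m0; have Nx := MN x Mx.
have /subspace_continuousP/(_ x (nbhs_singleton Nx)) := L_continuous.
move=> /cvgrPdist_lt/(_ _ m0) Lm.
have {}Lm : \forall y \near x, N y -> `|L x - L y| < m := Lm.
apply: filterS2 Nx Lm => y Ny /(_ Ny); rewrite (L0 Mx) sub0r normrN.
exact/le_lt_trans/ler_norm.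
Qed.

Hypothesis X_locally_compact : locally_compact [set: X].
Hypothesis M_compact : compact M.
Hypothesis MN : set_nbhs M N.

Lemma lyapunov_function_stable : lyapunov_stable phi M.
Proof.
move=> U MU; have [K [cK MK KNU]] :=
  compact_set_nbhs X_locally_compact M_compact (filterI MN MU).
have KN : K `<=` N by move=> x /KNU[].
have clK : closed K by apply: compact_closed cK; exact: metric_hausdorff.
have [m m0 Km] : exists2 m, 0 < m & forall x, (K `\` K°) x -> m <= L x.
  apply: compact_L_ge.
  - by apply: compact_closedI => //; apply: open_closedC; exact: open_interior.
  - by move=> x [/KN].
  - by move=> x [_ nKx] /MK.
exists (K `&` [set x | L x < m]).
  by move=> x Mx; apply: filterI; [exact: MK | exact: near_L_lt].
move=> _ [x [Kx Lx] /pos_semitrajectoryP[t t0 <-]].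
by have [] := KNU _ (sublevel_positively_invariant clK KN Km Kx Lx t0).
Qed.

(** Sampling at integer times gives a cluster point [y]. Choosing [u n >= n] with the sample within
    [1 / (n + 1)] of [y] yields times tending to infinity, with no need for [u] to be monotone. *)
Lemma compact_orbit_omega_limit x K : compact K ->
  (forall t, 0 <= t -> K (phi (x, t))) -> omega_limit phi x !=set0.
Proof.
move=> cK xK; pose F := (fun n : nat => phi (x, n%:R)) @ \oo.
have FK : F K by exists 0%N => // n _; exact: xK.
have FF : ProperFilter F by exact: fmap_proper_filter.
have [y [Ky yF]] := cK F FF FK.
have un n : exists k, (n <= k)%N /\ ball y n.+1%:R^-1 (phi (x, k%:R)).
  have Fn : F [set phi (x, k%:R) | k in [set k | (n <= k)%N]].
    by exists n => // k nk; exists k.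
  have n0 : 0 < n.+1%:R^-1 :> R by rewrite invr_gt0.
  by have [_ [[k nk <-] yk]] := yF _ _ Fn (nbhsx_ballx y _ n0); exists k.
have [u uE] := choice un.
exists y, (fun n => (u n)%:R).
  apply/cvgryPge => A; near=> n.
  apply: (@le_trans _ _ n%:R); last by rewrite ler_nat; have [] := uE n.
  by near: n; have /cvgryPge/(_ A) := @cvgr_idn R.
apply/cvg_ballP => e e0; near=> n.
have [_ yn] := uE n; apply: le_ball yn; apply: ltW.
by near: n; exact: (near_infty_natSinv_lt (PosNum e0)).
Unshelve. all: by end_near. Qed.

(** An invariance argument in the style of LaSalle: the forward orbit of a limit point [y] consists
    of limits of the orbit of [x], so [L] cannot fall below [L y] along it; outside [M] this
    contradicts strict decrease. *)
Lemma lyapunov_function_omega_limit x K : closed K -> K `<=` N ->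
  (forall t, 0 <= t -> K (phi (x, t))) -> omega_limit phi x `<=` M.
Proof.
move=> clK KN xK y [u uoo uy]; apply: contrapT => nMy.
have u0 A : \forall n \near \oo, A <= u n by have /cvgryPge/(_ A) := uoo.
have uy_s s : phi (x, u n + s) @[n --> \oo] --> phi (y, s).
  under eq_fun do rewrite -flowD//.
  exact: (cvg_comp _ _ uy (flow_continuous_space phi_dyn (t := s) (x := y))).
have xuK s : 0 <= s -> \forall n \near \oo, K (phi (x, u n + s)).
  by move=> s0; apply: filterS (u0 0) => n un0; apply: xK; rewrite addr_ge0.
have yK s : 0 <= s -> K (phi (y, s)).
  by move=> s0; exact: closed_cvg clK (xuK s s0) _ (uy_s s).
have Ny : N y by rewrite -(flow0 phi_dyn y); apply/KN/yK.
have xN t : 0 <= t -> N (phi (x, t)) by move=> /xK/KN.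
have Lu s : 0 <= s -> L (phi (x, u n + s)) @[n --> \oo] --> L (phi (y, s)).
  move=> s0; apply: cvg_within_comp L_continuous _ (KN _ (yK s s0)) (uy_s s).
  by apply: filterS (xuK s s0) => n /KN.
(* [L y] is the limit of [L] at the times [u n], which eventually exceed [t]. *)
have Lxy t : 0 <= t -> L y <= L (phi (x, t)).
  move=> t0; have := Lu 0 (lexx 0); rewrite flow0//.
  apply: (closed_cvg (fun z => z <= L (phi (x, t)))); first exact: closed_le.
  apply: filterS (u0 t) => n tn; rewrite addr0.
  by apply: L_nonincreasing2 => //; rewrite t0.
(* Any positive time would serve in place of 1. *)
have : L y <= L (phi (y, 1)).
  apply: (closed_cvg (fun z => L y <= z)) (Lu 1 ler01); first exact: closed_ge.
  by apply: filterS (u0 0) => n un0; apply: Lxy; rewrite addr_ge0.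
apply/negP; rewrite -ltNge; apply: L_lt => //.
by apply/flow_imageP => s /andP[/yK/KN].
Qed.

Lemma lyapunov_function_attracting : attracting phi M.
Proof.
have [K [cK MK KN]] := compact_set_nbhs X_locally_compact M_compact MN.
have clK : closed K by apply: compact_closed cK; exact: metric_hausdorff.
(* Stability applied to [K] itself confines all orbits starting near [M] to one compact subset of
   [N]. *)
have [N' MN' N'K] := lyapunov_function_stable MK.
move=> x Mx; apply: filterS (MN' x Mx) => y N'y.
have yK t : 0 <= t -> K (phi (y, t)).
  by move=> t0; apply: N'K; exists y => //; apply/pos_semitrajectoryP; exists t.
split; first exact: compact_orbit_omega_limit yK.
exact: lyapunov_function_omega_limit yK.
Qed.

End lyapunov_sufficient.

Theorem theorem21 (R : realType) (X : metricType R) (phi : X * R -> X)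
    (M : set X)
    (X_locally_compact : locally_compact [set: X])
    (phi_dynamical : dynamical_system phi)
    (M_nonempty : M !=set0)
    (M_compact : compact M) :
  asymptotically_stable phi M <->
  exists (N : set X) (L : X -> R),
    [/\ set_nbhs M N,
        {within N, continuous L},
        (forall x, M x -> L x = 0) /\
        (forall x, (N `\` M) x -> 0 < L x) &
        forall x (t : R), (N `\` M) x -> 0 < t ->
          flow_image phi x `[0, t] `<=` N -> L (phi (x, t)) < L x].
Proof.
split=> [[M_stable M_attracting]|[N [L [MN Lc [L0 L_gt0] L_lt]]]].
  (* The region of attraction is a neighborhood of [M] precisely because [M] is attracting. *)
  exists (region_of_attraction phi M), (lyap phi M); split=> //.
  - move=> x; apply: continuous_in_subspaceT => y /set_mem.
    exact: lyap_continuous.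
  - split=> x; first exact: lyap0.
    move=> [Ax nMx]; apply: lyap_gt0 => //.
    by apply: compact_closed M_compact; exact: metric_hausdorff.
  - move=> x t [Ax nMx] t0 _; apply: lyap_lt => //.
    by apply: compact_closed M_compact; exact: metric_hausdorff.
by split; [apply: lyapunov_function_stable MN |
  apply: lyapunov_function_attracting MN].
Qed.
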